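(* For a finite rack $(X,\triangleleft)$, the following statements are equivalent: (1) $G_{(X,\triangleleft)}$ is bi-orderable; (2) $G_{(X,\triangleleft)}$ is left-orderable; (3) $G_{(X,\triangleleft)}$ has no torsion; (4) $G_{(X,\triangleleft)}$ is free abelian; (5) $G_{(X,\triangleleft)}$ is abelian; (6) the induced injective rack $X/\!\approx$ of $(X,\triangleleft)$ is trivial. Any of these statements implies that $(X,\triangleleft)$ is a multipermutation rack of level at most $2$.
   Context: A (right) rack $(X,\triangleleft)$ is a (here nonempty) set $X$ with a binary operation satisfying $(x\triangleleft y)\triangleleft z=(x\triangleleft z)\triangleleft(y\triangleleft z)$ for all $x,y,z$, such that every right translation $x\mapsto x\triangleleft y$ is a bijection of $X$. It is trivial if $x\triangleleft y=x$ for all $x,y$. Its structure group is $G_{(X,\triangleleft)}=\langle X\mid xy=y\,(x\triangleleft y),\ x,y\in X\rangle$. The induced injective rack is the quotient $X/\!\approx$ with the operation induced by $\triangleleft$, where $x\approx x'$ if and only if $x$ and $x'$ represent the same element of $G_{(X,\triangleleft)}$. The retraction $\mathrm{Ret}(X,\triangleleft)$ is the rack induced by $\triangleleft$ on $X/\!\sim$, where $x\sim x'$ if and only if $z\triangleleft x=z\triangleleft x'$ for all $z\in X$. A rack is multipermutation of level $n$ if $n$ is the minimal non-negative integer such that $\#\mathrm{Ret}^n(X,\triangleleft)=1$. A group is left-orderable if it admits a total order stable under left translations, and bi-orderable if it admits a total order stable under both left and right translations. Having no torsion means having no non-trivial element of finite order. *)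

(* Defs.v *)
From HB Require Import structures.
From mathcomp Require Import all_boot all_order all_algebra.
From mathcomp Require Import boolp.
From mathcomp Require Import freeg.

Set Implicit Arguments.
Unset Strict Implicit.
Unset Printing Implicit Defensive.

Reserved Notation "x ◁ y" (at level 40, left associativity).

Local Open Scope quotient_scope.
Local Open Scope group_scope.

HB.mixin Record isRack X := {
  rack_op : X -> X -> X;
  rack_opD : forall x y z,
    rack_op (rack_op x y) z = rack_op (rack_op x z) (rack_op y z);
  rack_op_bij : forall y, bijective (rack_op^~ y);
  rack_nonempty : inhabited X
}.

#[short(type="rackType")]
HB.structure Definition Rack := {X of isRack X & Choice X}.

#[short(type="finRackType")]
HB.structure Definition FinRack := {X of isRack X & Finite X}.

Notation "x ◁ y" := (rack_op x y).

Definition trivial_rack (X : rackType) : Prop := forall x y : X, x ◁ y = x.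

Lemma rack_op_inj (X : rackType) (y : X) : injective (rack_op^~ y).
Proof. exact: bij_inj (rack_op_bij y). Qed.

Lemma rack_op_surj (X : rackType) (y z : X) : exists x, x ◁ y = z.
Proof. by have [g _ gK] := rack_op_bij y; exists (g z); apply: gK. Qed.

(* [cong_cancel] is what makes right translations injective on the quotient *)
Record rack_cong (X : rackType) := RackCong {
  cong_rel :> rel X;
  cong_equiv : equivalence_rel cong_rel;
  cong_op : forall x x' y y',
    cong_rel x x' -> cong_rel y y' -> cong_rel (x ◁ y) (x' ◁ y');
  cong_cancel : forall x x' y, cong_rel (x ◁ y) (x' ◁ y) -> cong_rel x x'
}.

Section QuotientRack.
Variables (X : rackType) (c : rack_cong X).

Lemma cong_refl : reflexive c.
Proof. by move=> x; case: (cong_equiv c x x x). Qed.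

Lemma cong_sym : symmetric c.
Proof.
move=> x y; apply/idP/idP => xy.
  by have [_ /(_ xy) <-] := cong_equiv c x y x; apply: cong_refl.
by have [_ /(_ xy) <-] := cong_equiv c y x y; apply: cong_refl.
Qed.

Lemma cong_trans : transitive c.
Proof. by move=> y x z xy yz; have [_ /(_ xy) ->] := cong_equiv c x y z. Qed.

Canonical cong_equiv_rel := EquivRel c cong_refl cong_sym cong_trans.
Canonical cong_enc_mod_rel := defaultEncModRel c.

Definition rack_quot := {eq_quot c}.

HB.instance Definition _ := Choice.on rack_quot.
HB.instance Definition _ := Quotient.on rack_quot.
HB.instance Definition _ : EqQuotient X c rack_quot := EqQuotient.on rack_quot.

Lemma rack_quotP (x y : X) :
  (\pi_rack_quot x = \pi_rack_quot y) <-> c x y.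
Proof. by split=> [/eqmodP|xy]; last apply/eqmodP. Qed.

Definition rack_quot_op := lift_op2 rack_quot (@rack_op X).

Lemma pi_rack_quot_op : {morph \pi_rack_quot : x y / x ◁ y >-> rack_quot_op x y}.
Proof.
move=> x y; unlock rack_quot_op; apply/rack_quotP.
by apply: cong_op; apply/rack_quotP; rewrite reprK.
Qed.

Lemma rack_quot_opD (x y z : rack_quot) :
  rack_quot_op (rack_quot_op x y) z =
  rack_quot_op (rack_quot_op x z) (rack_quot_op y z).
Proof.
elim/quotW: x => x; elim/quotW: y => y; elim/quotW: z => z.
by rewrite -!pi_rack_quot_op rack_opD.
Qed.

Lemma rack_quot_op_bij (y : rack_quot) : bijective (rack_quot_op^~ y).
Proof.
elim/quotW: y => y; have [g gK Kg] := rack_op_bij y.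
exists (fun x => \pi_rack_quot (g (repr x))) => x; last first.
  by rewrite -pi_rack_quot_op Kg reprK.
elim/quotW: x => x; rewrite -pi_rack_quot_op; apply/rack_quotP.
apply: (@cong_cancel _ c _ _ y); rewrite Kg.
by apply/rack_quotP; rewrite reprK.
Qed.

Lemma rack_quot_nonempty : inhabited rack_quot.
Proof. by case: (@rack_nonempty X) => x; constructor; exact: (\pi x). Qed.

HB.instance Definition _ := isRack.Build rack_quot
  rack_quot_opD rack_quot_op_bij rack_quot_nonempty.

End QuotientRack.

Section Presentation.
Variables (X : choiceType).

(* [(false, x)] stands for the letter [x] and [(true, x)] for its inverse *)
Definition word := seq (bool * X).

Definition word_inv (w : word) : word := rev [seq (~~ a.1, a.2) | a <- w].

Variable R : word -> word -> Prop.

Inductive pres_eq : word -> word -> Prop :=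
  | PresRel u v : R u v -> pres_eq u v
  | PresCancel b x : pres_eq [:: (b, x); (~~ b, x)] [::]
  | PresRefl u : pres_eq u u
  | PresSym u v : pres_eq u v -> pres_eq v u
  | PresTrans u v w : pres_eq u v -> pres_eq v w -> pres_eq u w
  | PresCat u u' v v' :
      pres_eq u u' -> pres_eq v v' -> pres_eq (u ++ v) (u' ++ v').

Definition pres_rel : rel word := fun u v => `[< pres_eq u v >].

Lemma pres_refl : reflexive pres_rel.
Proof. by move=> u; apply/asboolP/PresRefl. Qed.

Lemma pres_sym : symmetric pres_rel.
Proof. by move=> u v; apply/asboolP/asboolP; apply: PresSym. Qed.

Lemma pres_trans : transitive pres_rel.
Proof.
by move=> v u w /asboolP uv /asboolP vw; apply/asboolP/(PresTrans uv vw).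
Qed.

Canonical pres_equiv := EquivRel pres_rel pres_refl pres_sym pres_trans.
Canonical pres_enc_mod_rel := defaultEncModRel pres_rel.

Definition presented := {eq_quot pres_rel}.

HB.instance Definition _ := Choice.on presented.
HB.instance Definition _ := Quotient.on presented.
HB.instance Definition _ : EqQuotient word pres_rel presented :=
  EqQuotient.on presented.

Lemma pres_eqP (u v : word) :
  (\pi_presented u = \pi_presented v) <-> pres_eq u v.
Proof. by split=> [/eqmodP/asboolP|uv]; last apply/eqmodP/asboolP. Qed.

Definition presented_one : presented := \pi [::].
Definition presented_mul := lift_op2 presented (@cat (bool * X)).
Definition presented_inv := lift_op1 presented word_inv.

Lemma word_invK : involutive word_inv.
Proof.
move=> w; rewrite /word_inv map_rev revK -map_comp -[RHS]map_id.
by apply: eq_map => -[b x] /=; rewrite negbK.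
Qed.

Lemma pres_eq_mulV w : pres_eq (w ++ word_inv w) [::].
Proof.
elim: w => [|[b x] w IHw]; first exact: PresRefl.
have -> : ((b, x) :: w) ++ word_inv ((b, x) :: w) =
    [:: (b, x)] ++ ((w ++ word_inv w) ++ [:: (~~ b, x)]).
  by rewrite /word_inv /= rev_cons -cats1 catA.
apply: PresTrans (PresCancel b x).
by apply: (PresCat (PresRefl _)) (PresCat IHw (PresRefl _)).
Qed.

Lemma pres_eq_mulVl w : pres_eq (word_inv w ++ w) [::].
Proof. by rewrite -{2}[w]word_invK; apply: pres_eq_mulV. Qed.

Lemma pres_eq_inv u v : pres_eq u v -> pres_eq (word_inv u) (word_inv v).
Proof.
move=> uv; apply: (@PresTrans _ (word_inv u ++ (v ++ word_inv v))).
  rewrite -{1}[word_inv u]cats0; apply: PresCat (PresRefl _) _.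
  exact/PresSym/pres_eq_mulV.
rewrite catA -{2}[word_inv v]cat0s; apply: PresCat (PresRefl _).
apply: PresTrans (pres_eq_mulVl u).
by apply: PresCat (PresRefl _) _; apply: PresSym.
Qed.

Lemma pi_presented_mul :
  {morph \pi_presented : u v / u ++ v >-> presented_mul u v}.
Proof.
move=> u v; unlock presented_mul; apply/pres_eqP.
by apply: PresCat; apply/pres_eqP; rewrite reprK.
Qed.

Lemma pi_presented_inv :
  {morph \pi_presented : u / word_inv u >-> presented_inv u}.
Proof.
move=> u; unlock presented_inv; apply/pres_eqP.
by apply: pres_eq_inv; apply/pres_eqP; rewrite reprK.
Qed.

Lemma presented_mulA : associative presented_mul.
Proof.
elim/quotW=> u; elim/quotW=> v; elim/quotW=> w.
by rewrite -!pi_presented_mul catA.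
Qed.

Lemma presented_mul1 : left_id presented_one presented_mul.
Proof. by elim/quotW=> u; rewrite -pi_presented_mul. Qed.

Lemma presented_mulr1 : right_id presented_one presented_mul.
Proof. by elim/quotW=> u; rewrite -pi_presented_mul cats0. Qed.

Lemma presented_mulV : left_inverse presented_one presented_inv presented_mul.
Proof.
elim/quotW=> u; rewrite -pi_presented_inv -pi_presented_mul.
exact/pres_eqP/pres_eq_mulVl.
Qed.

Lemma presented_mulrV : right_inverse presented_one presented_inv presented_mul.
Proof.
elim/quotW=> u; rewrite -pi_presented_inv -pi_presented_mul.
exact/pres_eqP/pres_eq_mulV.
Qed.

HB.instance Definition _ := isGroup.Build presented
  presented_mulA presented_mul1 presented_mulr1 presented_mulV presented_mulrV.

Definition presented_gen (x : X) : presented := \pi [:: (false, x)].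

End Presentation.

Section StructureGroup.
Variable X : rackType.

Definition structure_relation (u v : word X) : Prop :=
  exists x y : X,
    u = [:: (false, x); (false, y)] /\ v = [:: (false, y); (false, x ◁ y)].

Definition structure_group : groupType := presented structure_relation.

Definition structure_gen (x : X) : structure_group :=
  presented_gen structure_relation x.

Lemma structure_genE (x y : X) :
  structure_gen x * structure_gen y = structure_gen y * structure_gen (x ◁ y).
Proof.
have mulE z t : structure_gen z * structure_gen t =
    \pi_(presented structure_relation) [:: (false, z); (false, t)].
  exact: esym (@pi_presented_mul X structure_relation [:: (false, z)] _).
by rewrite !mulE; apply/pres_eqP/PresRel; exists x, y.
Qed.

Definition inj_rel : rel X := fun x x' => structure_gen x == structure_gen x'.

Lemma inj_rel_equiv : equivalence_rel inj_rel.
Proof. by move=> x y z; rewrite /inj_rel eqxx; split=> // /eqP ->. Qed.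

Lemma structure_gen_op (x y : X) :
  structure_gen (x ◁ y) = structure_gen x ^ structure_gen y.
Proof. by rewrite /conjg structure_genE mulKg. Qed.

Lemma inj_rel_op (x x' y y' : X) :
  inj_rel x x' -> inj_rel y y' -> inj_rel (x ◁ y) (x' ◁ y').
Proof. by rewrite /inj_rel !structure_gen_op => /eqP -> /eqP ->. Qed.

Lemma inj_rel_cancel (x x' y : X) : inj_rel (x ◁ y) (x' ◁ y) -> inj_rel x x'.
Proof. by rewrite /inj_rel !structure_gen_op (inj_eq (@conjg_inj _ _)). Qed.

Definition inj_cong : rack_cong X :=
  RackCong inj_rel_equiv inj_rel_op inj_rel_cancel.

Definition inj_rack : rackType := rack_quot inj_cong.

End StructureGroup.

Section Retraction.
Variable X : rackType.

Definition ret_rel : rel X := fun x x' => `[< forall z : X, z ◁ x = z ◁ x' >].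

Lemma ret_rel_equiv : equivalence_rel ret_rel.
Proof.
move=> x y z; split; first exact/asboolP.
move=> /asboolP xy; apply/asboolP/asboolP => [xz|yz] t.
  by rewrite -xy.
by rewrite xy.
Qed.

Lemma ret_rel_op (x x' y y' : X) :
  ret_rel x x' -> ret_rel y y' -> ret_rel (x ◁ y) (x' ◁ y').
Proof.
move=> /asboolP xx' /asboolP yy'; apply/asboolP => z; rewrite -(yy' x').
by have [w <-] := rack_op_surj y z; rewrite -!rack_opD xx'.
Qed.

Lemma ret_rel_cancel (x x' y : X) : ret_rel (x ◁ y) (x' ◁ y) -> ret_rel x x'.
Proof.
move=> /asboolP xx'; apply/asboolP => z; apply: (@rack_op_inj _ y).
by rewrite rack_opD xx' -rack_opD.
Qed.

Definition ret_cong : rack_cong X :=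
  RackCong ret_rel_equiv ret_rel_op ret_rel_cancel.

Definition Ret : rackType := rack_quot ret_cong.

End Retraction.

Definition one_element (X : Type) : Prop := exists x : X, forall y : X, y = x.

Definition multipermutation_level (n : nat) (X : rackType) : Prop :=
  one_element (iter n Ret X) /\
  forall m, (m < n)%N -> ~ one_element (iter m Ret X).

Section GroupProperties.
Variable G : groupType.

Definition total_order (le : rel G) : Prop :=
  [/\ reflexive le, antisymmetric le, transitive le & total le].

Definition left_stable (le : rel G) : Prop :=
  forall g x y : G, le x y -> le (g * x) (g * y).

Definition right_stable (le : rel G) : Prop :=
  forall g x y : G, le x y -> le (x * g) (y * g).

Definition left_orderable : Prop :=
  exists le : rel G, total_order le /\ left_stable le.

Definition bi_orderable : Prop :=
  exists le : rel G, [/\ total_order le, left_stable le & right_stable le].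

Definition torsion_free : Prop :=
  forall (g : G) (n : nat), (0 < n)%N -> g ^+ n = 1 -> g = 1.

Definition abelian_group : Prop := forall x y : G, x * y = y * x.

Definition free_abelian : Prop :=
  exists (I : choiceType) (f : G -> {freeg I}),
    bijective f /\ forall x y : G, f (x * y) = (f x + f y)%R.

End GroupProperties.

(* Main.v *)
Require Import Defs.
From mathcomp Require Import all_boot.
From mathcomp Require Import all_order fingroup perm cyclic.
From mathcomp Require Import ssralg ssrnum ssrint.
From mathcomp Require Import generic_quotient boolp freeg.

(** Write [gen x] for the generator of the structure group G attached to [x].
    The defining relations say that [gen (x ◁ y)] is the conjugate of [gen x]
    by [gen y].  Hence G acts on X on the right, the orbits of this action index
    the conjugacy classes of generators, and counting the letters of a word with
    signs, orbit by orbit, is a surjective morphism [degree] from G to the free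
    abelian group on the orbits.  The theorem reduces to the injectivity of
    [degree].

    In a finite rack there is an n > 0 such that every [gen x ^+ n] is central;
    being central, it depends only on the orbit of [x].  Two facts follow.
    - A quotient of two products of such powers is determined by its degree
      ([degree0_fraction]).
    - A word in which some letter occurs n times yields a central factor
      [gen x ^+ n] ([gather]), so every element of G is a short positive word
      times a quotient of products of central powers.
    There are finitely many short words, so for any g in G two powers with
    distinct exponents share the same one, and a positive power of g is a quotient of products of
    central powers.  If moreover g has degree 0, this power is 1 by the first
    fact: the kernel of [degree] consists of torsion elements
    ([degree0_torsion]).  So if G is torsion-free then [degree] is an
    isomorphism onto a free abelian group.

    Conversely, if the injective rack is trivial, the generators commute, the
    choice n = 1 is allowed, every element is a quotient of products of
    generators and [degree] is injective ([commuting_degree0]).  Pulling back a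
    lexicographic order along [degree] then bi-orders G.  The remaining
    implications hold in every group or are immediate.

    For the last claim, [z ◁ x] depends only on [gen x], because G acts on X.
    When the injective rack is trivial, [x ◁ y] and [x] have the same generator,
    so they are identified in the retraction, which is thus a trivial rack; the
    retraction of a trivial rack has one element. *)

Set Implicit Arguments.
Unset Strict Implicit.
Unset Printing Implicit Defensive.

Local Open Scope quotient_scope.
Local Open Scope group_scope.

(** * The action of the structure group on the rack *)

Section StructureGroupWords.
Variable X : rackType.
Notation G := (structure_group X).
Notation gen := (@structure_gen X).
Implicit Types (x y z : X) (a : bool * X) (w : word X) (g : G).

Definition gword w : G := \pi_(presented (@structure_relation X)) w.

Lemma gword_cat u v : gword (u ++ v) = gword u * gword v.
Proof. exact: pi_presented_mul. Qed.

Lemma gword_gen x : gword [:: (false, x)] = gen x.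
Proof. by []. Qed.

Lemma gword_genV x : gword [:: (true, x)] = (gen x)^-1.
Proof. exact: (@pi_presented_inv _ (@structure_relation X) [:: (false, x)]). Qed.

Lemma structure_group_ind (P : G -> Prop) :
  P 1 -> (forall x g, P g -> P (gen x * g)) ->
  (forall x g, P g -> P ((gen x)^-1 * g)) -> forall g, P g.
Proof.
move=> P1 PM PV; elim/quotW=> w; rewrite -/(gword w).
elim: w => [|[[] x] w IHw]; first exact: P1.
  by rewrite -cat1s gword_cat gword_genV; apply: PV.
by rewrite -cat1s gword_cat; apply: PM.
Qed.

Definition rack_div y z : X := sval (cid (rack_op_surj y z)).

Lemma rack_divK y z : rack_div y z ◁ y = z.
Proof. exact: svalP (cid (rack_op_surj y z)). Qed.

Lemma rack_opK y z : rack_div y (z ◁ y) = z.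
Proof. by apply: (@rack_op_inj _ y); rewrite rack_divK. Qed.

Definition act_letter x a : X := if a.1 then rack_div a.2 x else x ◁ a.2.

Definition act x w : X := foldl act_letter x w.

Lemma act_cat x u v : act x (u ++ v) = act (act x u) v.
Proof. exact: foldl_cat. Qed.

(** The action of words is an action of G: the relation x y = y (x ◁ y) is
    respected because of self-distributivity. *)
Lemma act_gword u v : gword u = gword v -> act^~ u =1 act^~ v.
Proof.
move/pres_eqP; elim=> {u v} [u v [x [y [-> ->]]]|b x|u|u v _ IH
  |u v w _ IHu _ IHv|u u' v v' _ IHu _ IHv] z //=.
- by rewrite /act /= /act_letter /= rack_opD.
- by case: b; rewrite /act /= /act_letter /= ?rack_divK ?rack_opK.
- by rewrite IHu IHv.
- by rewrite !act_cat IHu IHv.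
Qed.

Lemma act_invK x w : act (act x w) (word_inv w) = x.
Proof.
rewrite -act_cat (@act_gword _ [::]) //.
exact/pres_eqP/pres_eq_mulV.
Qed.

Lemma gen_act x w : gen (act x w) = gen x ^ gword w.
Proof.
elim/last_ind: w => [|w [b y] IHw] /=; first by rewrite conjg1.
rewrite -cats1 act_cat gword_cat conjgM -IHw.
case: b; rewrite /act /= /act_letter /= ?gword_genV ?gword_gen.
  by apply: (canRL (conjgK _)); rewrite -structure_gen_op rack_divK.
exact: structure_gen_op.
Qed.

(** * Orbits and the degree morphism *)

Definition orbit_rel : rel X := fun x y => `[< exists w, act x w = y >].

Lemma orbit_equiv : equivalence_rel orbit_rel.
Proof.
move=> x y z; split; first by apply/asboolP; exists [::].
move=> /asboolP [w wx]; apply/asboolP/asboolP => -[w' w'z].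
  by exists (word_inv w ++ w'); rewrite act_cat -wx act_invK.
by exists (w ++ w'); rewrite act_cat wx.
Qed.

Lemma orbit_rel_op x x' y y' :
  orbit_rel x x' -> orbit_rel y y' -> orbit_rel (x ◁ y) (x' ◁ y').
Proof.
move=> /asboolP [w wx] _; apply/asboolP.
exists ((true, y) :: w ++ [:: (false, y')]).
by rewrite -cat1s !act_cat /act /= /act_letter /= rack_opK -/(act x w) wx.
Qed.

Lemma orbit_rel_cancel x x' y : orbit_rel (x ◁ y) (x' ◁ y) -> orbit_rel x x'.
Proof.
move=> /asboolP [w wx]; apply/asboolP.
exists ((false, y) :: w ++ [:: (true, y)]).
rewrite -cat1s !act_cat /act /= /act_letter /= -/(act (x ◁ y) w) wx.
exact: rack_opK.
Qed.

Definition orbit_cong : rack_cong X :=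
  RackCong orbit_equiv orbit_rel_op orbit_rel_cancel.

(** This quotient indexes the basis of the abelianization of G, since the
    generators of one orbit are conjugate. *)
Definition orbits : rackType := rack_quot orbit_cong.

Definition orbit_of x : orbits := \pi_(rack_quot orbit_cong) x.

Lemma orbit_ofP x y :
  reflect (exists w, act x w = y) (orbit_of x == orbit_of y).
Proof.
apply: (iffP eqP) => [/(rack_quotP orbit_cong)/asboolP //|xy].
exact/(rack_quotP orbit_cong)/asboolP.
Qed.

Lemma orbit_of_op x y : orbit_of (x ◁ y) = orbit_of x.
Proof.
by apply/esym/eqP/orbit_ofP; exists [:: (false, y)].
Qed.

Definition degree_letter a : {freeg orbits} :=
  if a.1 then (- [freeg [:: (1, orbit_of a.2)]])%R
  else [freeg [:: (1, orbit_of a.2)]]%R.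

(** The abelianization of G, evaluated on the canonical word representing an
    element; [degree_gword] shows that any other word gives the same value. *)
Definition degree g : {freeg orbits} :=
  (\sum_(a <- (repr g : word X)) degree_letter a)%R.

Lemma degree_gword w : degree (gword w) = (\sum_(a <- w) degree_letter a)%R.
Proof.
suff: forall u v, gword u = gword v ->
    (\sum_(a <- u) degree_letter a = \sum_(a <- v) degree_letter a)%R.
  by move=> inv; apply: inv; rewrite /gword reprK.
move=> u v /pres_eqP; elim=> {u v w} [u v [x [y [-> ->]]]|b x|u|u v _ IH
  |u v w _ IHu _ IHv|u u' v v' _ IHu _ IHv] //.
- rewrite !big_cons !big_nil /degree_letter /= orbit_of_op !GRing.addr0.
  exact: GRing.addrC.
- by rewrite !big_cons !big_nil /degree_letter; case: b => /=;
    rewrite GRing.addr0 ?GRing.addNr ?GRing.subrr.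
- by rewrite IHu.
- by rewrite !big_cat IHu IHv.
Qed.

Lemma degreeM g g' : degree (g * g') = (degree g + degree g')%R.
Proof.
elim/quotW: g => u; elim/quotW: g' => v.
by rewrite -!/(gword _) -gword_cat !degree_gword big_cat.
Qed.

Lemma degree1 : degree 1 = 0%R.
Proof. by rewrite -[1]/(gword [::]) degree_gword big_nil. Qed.

Lemma degreeV g : degree g^-1 = (- degree g)%R.
Proof.
by apply: (GRing.addIr (degree g)); rewrite -degreeM mulVg degree1 GRing.addNr.
Qed.

Lemma degree_gen x : degree (gen x) = [freeg [:: (1, orbit_of x)]]%R.
Proof. by rewrite -gword_gen degree_gword big_seq1. Qed.

Lemma degreeX g n : degree (g ^+ n) = (degree g *+ n)%R.
Proof.
elim: n => [|n IHn]; first by rewrite degree1.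
by rewrite expgS degreeM IHn GRing.mulrS.
Qed.

Lemma degree_surj D : exists g, degree g = D.
Proof.
rewrite -(freeg_sumE D); elim: (dom D) => [|o s [g gs]].
  by exists 1; rewrite big_nil degree1.
elim/quotW: o => x; rewrite -/(orbit_of x) big_cons.
have [k <-] : exists k,
    degree k = [freeg [:: (coeff (orbit_of x) D, orbit_of x)]].
  case: (coeff _ D) => n.
    by exists (gen x ^+ n); rewrite degreeX degree_gen freegU_muln natz.
  exists (gen x ^- n.+1).
  by rewrite degreeV degreeX degree_gen freegU_muln freegUN natz.
by rewrite -gs; exists (k * g); rewrite degreeM.
Qed.

End StructureGroupWords.

(** * Products of central powers of generators *)

Section CentralPowers.
Variables (X : rackType) (n : nat).
Notation G := (structure_group X).
Notation gen := (@structure_gen X).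
Hypothesis n_gt0 : 0 < n.
Hypothesis central : forall x y, commute (gen x ^+ n) (gen y).
Implicit Types (x y z : X) (p q v : seq X) (g : G).

Definition gprod v : G := \prod_(x <- v) gen x.
Definition power_prod p : G := \prod_(x <- p) gen x ^+ n.

Lemma central_power x g : commute (gen x ^+ n) g.
Proof.
elim/structure_group_ind: g => [|y g IHg|y g IHg]; first exact: commute1.
  exact: commuteM.
by apply: commuteM IHg; apply: commuteV.
Qed.

Lemma central_power_prod p g : commute g (power_prod p).
Proof. by apply: commute_prod => x _; apply/commute_sym/central_power. Qed.

(** Generators in the same orbit are conjugate, hence so are their n-th powers;
    conjugate central elements are equal. *)
Lemma central_power_orbit x y :
  orbit_of x = orbit_of y -> gen x ^+ n = gen y ^+ n.
Proof.
move/eqP/orbit_ofP => [w <-].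
by rewrite gen_act -conjXg conjgE central_power mulKg.
Qed.

Lemma coeff_degree_power_prod o p :
  coeff o (degree (power_prod p)) =
    Posz (n * count_mem o (map (@orbit_of X) p)).
Proof.
rewrite /power_prod; elim: p => [|x p IHp].
  by rewrite big_nil degree1 coeff0 muln0.
rewrite big_cons degreeM coeffD IHp degreeX coeffMn degree_gen coeffU /=.
by rewrite GRing.mul1r -GRing.mulrnA natz -PoszD mulnDr [(_ * n)%N]mulnC.
Qed.

(** The degree determines how many factors lie in each orbit, thus the sequence
    of orbits up to permutation; the factors commute and depend only on their
    orbits. *)
Lemma degree_power_prod_inj p q :
  degree (power_prod p) = degree (power_prod q) -> power_prod p = power_prod q.
Proof.
move=> eq_deg.
pose h (s : seq (orbits X)) : G := \prod_(o <- s) gen (repr o) ^+ n.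
have hE r : power_prod r = h (map (@orbit_of X) r).
  rewrite /h big_map; apply: eq_bigr => x _.
  by apply: central_power_orbit; rewrite /orbit_of reprK.
have perm_pq : perm_eq (map (@orbit_of X) p) (map (@orbit_of X) q).
  apply/allP => o _ /=; rewrite -(eqn_pmul2l n_gt0).
  by have /eqP := congr1 (coeff o) eq_deg; rewrite !coeff_degree_power_prod.
rewrite !hE; apply: (catCA_perm_ind (P := fun s => h _ = h s) _ perm_pq) => //.
move=> t1 t2 t3 ->; rewrite /h !big_cat /= !mulgA; congr (_ * _).
by apply: commute_prod => o _; apply/commute_sym/central_power.
Qed.

Lemma degree0_fraction g p q :
  g * power_prod q = power_prod p -> degree g = 0%R -> g = 1.
Proof.
move=> gqp g0; apply: (@mulIg _ (power_prod q)); rewrite mul1g gqp.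
by apply: degree_power_prod_inj; rewrite -gqp degreeM g0 GRing.add0r.
Qed.

(** The inverse of [gen x] is [gen x ^+ n.-1] divided by the central
    [gen x ^+ n], so all negative letters can be moved into a central
    denominator. *)
Lemma clear_denominators g : exists v q, g * power_prod q = gprod v.
Proof.
rewrite /power_prod /gprod.
elim/structure_group_ind: g => [|x g [v [q IHg]]|x g [v [q IHg]]].
- by exists [::], [::]; rewrite !big_nil mulg1.
- by exists (x :: v), q; rewrite big_cons -mulgA IHg.
exists (nseq n.-1 x ++ v), (x :: q).
rewrite big_cons !mulgA -[_ * g * _]mulgA -[X in _ * X * _](central_power x).
rewrite mulgA -mulgA IHg.
rewrite -(prednK n_gt0) expgS mulKg big_cat /=; congr (_ * _).
by rewrite big_nseq iter_mulg_1.
Qed.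

End CentralPowers.

Arguments gprod {X} v.
Arguments power_prod {X} n p.

(** Commuting generators are themselves central powers, with n = 1. *)
Lemma commuting_degree0 (X : rackType) :
  (forall x y, commute (@structure_gen X x) (structure_gen y)) ->
  forall g : structure_group X, degree g = 0%R -> g = 1.
Proof.
move=> gen_comm g.
have [v [q gqv]] := @clear_denominators X 1 isT gen_comm g.
exact: (@degree0_fraction X 1 isT gen_comm _ v q).
Qed.

(** * Elements of degree zero in the structure group of a finite rack *)

Section FiniteRack.
Variable X : finRackType.
Notation G := (structure_group X).
Notation gen := (@structure_gen X).
Implicit Types (x y z : X) (p q v : seq X) (g : G).

Lemma gen_mul_power x y k :
  gen y * gen x ^+ k = gen x ^+ k * gen (iter k (rack_op^~ x) y).
Proof.
elim: k => [|k IHk]; first by rewrite mulg1 mul1g.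
by rewrite expgSr !mulgA IHk -!mulgA structure_genE.
Qed.

(** Any common multiple of the orders of the right translations would do; they
    are elements of the permutation group of X, so its order is one. *)
Definition rack_exponent := #|{perm X}|.

Lemma rack_exponent_gt0 : 0 < rack_exponent.
Proof. by apply/card_gt0P; exists 1. Qed.

Lemma rack_exponent_central x y : commute (gen x ^+ rack_exponent) (gen y).
Proof.
apply/esym; rewrite gen_mul_power; congr (_ * gen _).
pose s := perm (@rack_op_inj X x).
rewrite (@eq_iter _ _ s) => [|z]; last by rewrite permE.
rewrite -permX.
suff -> : s ^+ rack_exponent = 1 by rewrite perm1.
by apply/eqP; rewrite -order_dvdn /rack_exponent -cardsT order_dvdG ?inE.
Qed.

(** Moving a letter [x] to the left across [y] only replaces [y] by [y ◁ x]; so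
    occurrences of [x] can be gathered in front without lengthening the word.
    Moving the leftmost ones first leaves the other occurrences untouched. *)
Lemma gather k x v : k <= count_mem x v ->
  exists2 v', size v' + k = size v & gprod v = gen x ^+ k * gprod v'.
Proof.
rewrite /gprod; elim: v k => [|y v IHv] k /=.
  by rewrite leqn0 => /eqP ->; exists [::]; rewrite ?mul1g.
case: eqVneq => [->|_]; last first.
  rewrite add0n => /IHv [v' sz_v' v'E]; exists (iter k (rack_op^~ x) y :: v').
    by rewrite /= addSn sz_v'.
  by rewrite !big_cons v'E mulgA gen_mul_power mulgA.
case: k => [|k]; first by exists (x :: v); rewrite ?addn0 ?mul1g.
rewrite add1n ltnS => /IHv [v' sz_v' v'E].
by exists v'; rewrite ?addnS ?sz_v' // big_cons v'E mulgA expgS.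
Qed.

Lemma size_sum_count v : size v = (\sum_x count_mem x v)%N.
Proof.
elim: v => [|y v IHv]; first by rewrite big1.
rewrite big_split /= -IHv (bigD1 y) //= eqxx big1 // => x /negPf.
by rewrite eq_sym => ->.
Qed.

Notation n := rack_exponent.
Definition short := (#|X| * n)%N.

(** A word longer than [short] contains some letter [rack_exponent] times, by the
    pigeonhole principle, and [gather] extracts a central power from it. *)
Lemma shorten v :
  exists v' p, size v' <= short /\ gprod v = power_prod n p * gprod v'.
Proof.
elim: {v}_.+1 {-2}v (ltnSn (size v)) => // m IHm v; rewrite ltnS => v_m.
have [v_short|v_long] := leqP (size v) short.
  by exists v, [::]; rewrite /power_prod big_nil mul1g.
have [x n_x] : exists x, n <= count_mem x v.
  apply/existsP; apply: contraLR v_long; rewrite negb_exists => /forallP few.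
  rewrite -leqNgt size_sum_count /short -sum_nat_const.
  by apply: leq_sum => x _; rewrite ltnW // ltnNge.
have [v1 sz_v1 vE] := gather n_x.
have [|v' [p [sz_v' v1E]]] := IHm v1.
  apply: leq_trans v_m; rewrite -sz_v1 -[X in X < _]addn0 ltn_add2l.
  exact: rack_exponent_gt0.
exists v', (x :: p); split=> //.
by rewrite vE v1E /power_prod big_cons mulgA.
Qed.

(** Short words are finitely many, so g ^+ i and g ^+ j have the same short part
    for some i < j, and g ^+ (j - i) is a quotient of products of central
    powers. *)
Lemma degree0_torsion g : degree g = 0%R -> exists2 m, 0 < m & g ^+ m = 1.
Proof.
move=> g0; pose T := short.-bseq X.
have /choice [F FE] (i : nat) : exists t : T * (seq X * seq X),
    g ^+ i * power_prod n t.2.2 = power_prod n t.2.1 * gprod t.1.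
  have [v [q gqv]] :=
    clear_denominators rack_exponent_gt0 rack_exponent_central (g ^+ i).
  have [v' [p [sz_v' vE]]] := shorten v.
  by exists (Bseq sz_v', (p, q)); rewrite gqv vE.
pose f (i : 'I_(#|{: T}|.+1)) := (F i).1.
have /injectivePn [i [j ij fij]] : ~~ injectiveb f.
  by apply/injectiveP => /leq_card; rewrite card_ord ltnn.
wlog lt_ij : i j ij fij / i < j.
  move=> IH; case: (ltngtP i j) => [|ji|eq_ij]; first exact: IH.
    by apply: (IH j i); rewrite // eq_sym.
  by rewrite (val_inj eq_ij) eqxx in ij.
have comm := central_power_prod rack_exponent_central.
exists (j - i); first by rewrite subn_gt0.
apply: (@degree0_fraction X n rack_exponent_gt0 rack_exponent_central _
  ((F j).2.1 ++ (F i).2.2) ((F j).2.2 ++ (F i).2.1)); last first.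
  by rewrite degreeX g0 GRing.mul0rn.
apply: (@mulgI _ (g ^+ i)); rewrite /power_prod !big_cat -!/(power_prod _ _).
rewrite mulgA -expgnDr subnKC ?(ltnW lt_ij) // mulgA FE.
rewrite -/(f j) -fij -mulgA [X in _ * X]comm mulgA.
by rewrite /= [RHS]mulgA (comm _ (g ^+ i)) -[RHS]mulgA FE mulgA.
Qed.

End FiniteRack.

(** * Orderable and free abelian groups *)

Section OrderableGroups.
Variable G : groupType.

Lemma bi_orderable_left : bi_orderable G -> left_orderable G.
Proof. by case=> le [le_total le_left _]; exists le. Qed.

(** The powers of an element above 1 increase, so if one of them is 1 the element
    is also below 1. *)
Lemma left_ordered_pos_torsion (le : rel G) g n :
    total_order le -> left_stable le ->
  le 1 g -> 0 < n -> g ^+ n = 1 -> g = 1.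
Proof.
move=> [le_refl le_anti le_trans _] le_left g_ge1; case: n => // n _ gn1.
have: le g (g ^+ n.+1).
  elim: n {gn1} => // n /le_trans; apply.
  by have := le_left (g ^+ n.+1) _ _ g_ge1; rewrite mulg1 -expgSr.
by rewrite gn1 => g_le1; apply: le_anti; rewrite g_le1.
Qed.

Lemma left_orderable_torsion_free : left_orderable G -> torsion_free G.
Proof.
move=> [le [le_order le_left]] g n n_gt0 gn1.
have [le_refl le_anti le_trans le_total] := le_order.
have [|g_le1] := orP (le_total 1 g).
  move=> g_ge1.
  exact: (left_ordered_pos_torsion le_order le_left g_ge1 n_gt0).
(* An element below 1 is above 1 for the opposite order. *)
apply: (@left_ordered_pos_torsion (fun x y => le y x) g n) => //.
  split=> // [x y /le_anti //|y x z xy yz]; exact: le_trans yz xy.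
by move=> x y z; apply: le_left.
Qed.

Lemma free_abelian_abelian : free_abelian G -> abelian_group G.
Proof.
move=> [I [f [/bij_inj f_inj fM]]] x y.
by apply: f_inj; rewrite !fM GRing.addrC.
Qed.

End OrderableGroups.

Lemma seqlexi_add (I : Type) (s : seq I) (f g h : I -> int) :
  (([seq (f i + h i)%R | i <- s] : seqlexi int) <=
     [seq (g i + h i)%R | i <- s])%O =
  (([seq f i | i <- s] : seqlexi int) <= [seq g i | i <- s])%O.
Proof.
elim: s => //= i s IHs.
by rewrite !Order.SeqLexiOrder.Exports.lexi_cons !Num.Theory.lerD2r IHs.
Qed.

(** * Consequences of the injectivity of the degree *)

Section DegreeInjective.
Variable X : rackType.
Notation G := (structure_group X).

Lemma degree_injective :
  (forall g : G, degree g = 0%R -> g = 1) -> injective (@degree X).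
Proof.
move=> deg0 g h eq_gh; apply/divg1_eq/deg0.
by rewrite degreeM degreeV eq_gh GRing.subrr.
Qed.

Lemma injective_degree_free_abelian : injective (@degree X) -> free_abelian G.
Proof.
move=> deg_inj; exists (orbits X), (@degree X); split; last exact: degreeM.
pose f D := sval (cid (@degree_surj X D)).
have fK : cancel f (@degree X) by move=> D; exact: svalP (cid (degree_surj D)).
by exists f => // g; apply: deg_inj; rewrite fK.
Qed.

End DegreeInjective.

(** The order compares degrees lexicographically.  Their coordinates are listed
    along the elements of X rather than along the orbits: this repeats some
    coordinates, but spares an enumeration of the orbits. *)
Lemma injective_degree_bi_orderable (X : finRackType) :
  injective (@degree X) -> bi_orderable (structure_group X).
Proof.
move=> deg_inj.
pose c (g : structure_group X) : seqlexi int :=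
  [seq coeff (orbit_of x) (degree g) | x <- enum X].
exists (fun g h => c g <= c h)%O.
have stable_r (k g h : structure_group X) :
    (c g <= c h)%O -> (c (g * k) <= c (h * k))%O.
  move=> le_gh.
  have cM (g' : structure_group X) : c (g' * k) =
      [seq coeff (orbit_of x) (degree g') + coeff (orbit_of x) (degree k)
      | x <- enum X]%R.
    by apply: eq_map => x; rewrite degreeM coeffD.
  by rewrite !cM seqlexi_add.
split=> //.
  split=> [g|g h /Order.POrderTheory.le_anti|h g k|g h].
  - exact: Order.POrderTheory.lexx.
  - move/eq_in_map => eq_c; apply: deg_inj; apply/eqP/freeg_eqP.
    by elim/quotW=> x; apply: eq_c; rewrite mem_enum.
  - exact: Order.POrderTheory.le_trans.
  - exact: Order.TotalTheory.le_total.
move=> k g h le_gh.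
have mulC (a b : structure_group X) : a * b = b * a.
  by apply: deg_inj; rewrite !degreeM GRing.addrC.
by rewrite !(mulC k); apply: stable_r.
Qed.

(** * Trivial injective racks and retractions *)

Section InjectiveRack.
Variable X : rackType.
Notation gen := (@structure_gen X).

Lemma abelian_trivial_inj_rack :
  abelian_group (structure_group X) -> trivial_rack (inj_rack X).
Proof.
move=> mulC; elim/quotW=> x; elim/quotW=> y.
rewrite -[LHS](@pi_rack_quot_op _ (inj_cong X)); apply/rack_quotP.
by rewrite /= /inj_rel structure_gen_op conjgE mulC mulgK.
Qed.

Lemma trivial_inj_rack_gen :
  trivial_rack (inj_rack X) -> forall x y, gen (x ◁ y) = gen x.
Proof.
move=> triv x y; apply/eqP/(rack_quotP (inj_cong X)).
by rewrite pi_rack_quot_op; apply: triv.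
Qed.

Lemma gen_op_commute :
  (forall x y, gen (x ◁ y) = gen x) -> forall x y, commute (gen x) (gen y).
Proof. by move=> triv x y; rewrite /commute structure_genE triv. Qed.

(** Both sides are values of the action of G on X. *)
Lemma gen_eq_rack_op x y z : gen x = gen y -> z ◁ x = z ◁ y.
Proof. by rewrite -!gword_gen => /act_gword /(_ z). Qed.

Lemma trivial_inj_rack_Ret : trivial_rack (inj_rack X) -> trivial_rack (Ret X).
Proof.
move=> /trivial_inj_rack_gen triv; elim/quotW=> x; elim/quotW=> y.
rewrite -[LHS](@pi_rack_quot_op _ (ret_cong X)).
by apply/rack_quotP/asboolP => z; apply: gen_eq_rack_op.
Qed.

Lemma trivial_rack_Ret_one_element : trivial_rack X -> one_element (Ret X).
Proof.
move=> triv; have [x] := @rack_nonempty X.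
exists (\pi_(rack_quot (ret_cong X)) x); elim/quotW=> y.
by apply/rack_quotP/asboolP => z; rewrite !triv.
Qed.

Lemma one_element_multipermutation n :
  one_element (iter n Ret X) -> exists2 m, m <= n & multipermutation_level m X.
Proof.
move=> one_n.
have ex : exists m, `[< one_element (iter m Ret X) >].
  by exists n; apply/asboolP.
case: (ex_minnP ex) => m /asboolP one_m m_min.
exists m; first by apply: m_min; apply/asboolP.
by split=> // k km /asboolP /m_min; rewrite leqNgt km.
Qed.

End InjectiveRack.

Theorem theorem7p14 (X : finRackType) :
  [<-> bi_orderable (structure_group X);
       left_orderable (structure_group X);
       torsion_free (structure_group X);
       free_abelian (structure_group X);
       abelian_group (structure_group X);
       trivial_rack (inj_rack X)]
  /\
  (bi_orderable (structure_group X) \/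
   left_orderable (structure_group X) \/
   torsion_free (structure_group X) \/
   free_abelian (structure_group X) \/
   abelian_group (structure_group X) \/
   trivial_rack (inj_rack X) ->
   exists2 n : nat, n <= 2 & multipermutation_level n X).
Proof.
have eqv : [<-> bi_orderable (structure_group X);
       left_orderable (structure_group X);
       torsion_free (structure_group X);
       free_abelian (structure_group X);
       abelian_group (structure_group X);
       trivial_rack (inj_rack X)].
  tfae.
  - exact: bi_orderable_left.
  - exact: left_orderable_torsion_free.
  - move=> tf; apply/injective_degree_free_abelian/degree_injective => g.
    by case/degree0_torsion => m; apply: tf.
  - exact: free_abelian_abelian.
  - exact: abelian_trivial_inj_rack.
  - move=> /trivial_inj_rack_gen /gen_op_commute gen_comm.
    exact/injective_degree_bi_orderable/degree_injective/commuting_degree0.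
split=> // any.
have triv : trivial_rack (inj_rack X).
  by case: any => [/(eqv 0%N 5%N)|[/(eqv 1%N 5%N)|[/(eqv 2%N 5%N)|
    [/(eqv 3%N 5%N)|[/(eqv 4%N 5%N)|]]]]].
apply: (@one_element_multipermutation X 2).
exact/trivial_rack_Ret_one_element/trivial_inj_rack_Ret.
Qed.
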